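(* Let $(n_1,n_2,n_3,\dots)$ be an infinite sequence of positive integers, and for $N\ge 0$ let $T(N)$ be the number of spanning trees of the checkerboard graph of $R(n_1,n_2,\dots,n_N)$. Then $$T(0)=1,\qquad T(1)=n_1,$$ and, for every $N\ge 1$, $$T(N+1)=n_{N+1}\,T(N)+T(N-1).$$
   Context: **Rational knots.** For positive integers $n_i$, $R(n_1,\dots,n_N)$ has the following diagram. Take four vertical strands, with positions numbered 1 to 4 from left to right, read from top to bottom. Join the tops of strands 1 and 2 by a cap and the tops of strands 3 and 4 by a cap. Then perform $N$ successive twists from top to bottom. The $i$-th twist consists of $n_i$ crossings, between positions 2 and 3 if $i$ is odd, and between positions 1 and 2 if $i$ is even. At the bottom, if $N$ is odd, join positions 1 and 2, and positions 3 and 4. If $N$ is even (including $N=0$, where there are no twists), join positions 2 and 3, and positions 1 and 4. All crossings are positive, meaning that, with respect to the checkerboard shading leaving the unbounded region unshaded, rotating the over-arc counterclockwise about the crossing sweeps out the shaded regions. (The over/under information does not affect the checkerboard graph.) **Checkerboard graph.** Shade the regions of the diagram so that, of any two regions meeting at a crossing and sharing a common boundary arc, exactly one is shaded, and so that the unbounded region is not shaded. The checkerboard graph is the multigraph whose vertices are the shaded regions, with one edge for each crossing, joining the shaded regions meeting at that crossing. Two vertices may be connected by more than one edge, and parallel edges are counted as distinct when counting spanning trees. *)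

(* Defs.v *)
From HB Require Import structures.
From mathcomp Require Import all_boot.

Set Implicit Arguments.
Unset Strict Implicit.
Unset Printing Implicit Defensive.

(** * Finite multigraphs and their spanning trees *)

(** [ends e] is the set of end points of [e]; a loop has a single end point. *)
Record multigraph := Multigraph {
  vertex : finType;
  edge : finType;
  ends : edge -> {set vertex}
}.

Section SpanningTrees.
Variable G : multigraph.
Implicit Types (F : {set edge G}) (u v : vertex G).

Definition joined F : rel (vertex G) :=
  fun u v => [exists e in F, ends e == [set u; v]].

Definition connected F : bool :=
  (0 < #|vertex G|) && [forall u, forall v, connect (joined F) u v].

(** The cycle v_1 -e_1- v_2 -e_2- ... v_k -e_k- v_1 is encoded as
    (v_1, e_1), ..., (v_k, e_k).  Loops (k = 1) and pairs of parallel edges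
    (k = 2) are cycles. *)
Definition graph_cycle F (c : seq (vertex G * edge G)) : bool :=
  [&& c != [::], uniq (unzip1 c), uniq (unzip2 c), all (mem F) (unzip2 c)
    & cycle (fun x y => ends x.2 == [set x.1; y.1]) c].

(** A cycle has at most [#|edge G|] edges, so the length can be bounded; see
    [acyclicP] below. *)
Definition acyclic F : bool :=
  [forall k : 'I_#|edge G|.+1,
     forall c : k.-tuple (vertex G * edge G), ~~ graph_cycle F c].

Lemma acyclicP F : reflect (forall c, ~~ graph_cycle F c) (acyclic F).
Proof.
apply: (iffP forallP) => [acF c | acF k]; last by apply/forallP => c; apply: acF.
apply/negP => cyc; have /and5P[_ _ Uc _ _] := cyc.
have lt_c: size c < #|edge G|.+1.
  by rewrite ltnS -(size_map snd c) -(card_uniqP Uc) max_card.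
by have /forallP/(_ (in_tuple c)) := acF (Ordinal lt_c); rewrite /= cyc.
Qed.

Definition spanning_trees : {set {set edge G}} :=
  [set F | connected F && acyclic F].

End SpanningTrees.

(** * Plane link diagrams

    A diagram in general position with respect to the height function is read
    from top to bottom as a sequence of events.  Between two events it consists
    of vertical strands, at positions 1, 2, ... from left to right.
    - [Cap p] creates two strands, which get positions p and p+1;
    - [Cup p] joins the strands at positions p and p+1;
    - [Cross p o] crosses the strands at positions p and p+1; [o] tells whether
      the over-arc runs from the upper left to the lower right. *)
Variant event := Cap of nat | Cup of nat | Cross of nat & bool.

Definition diagram := seq event.

Definition strands_after (w : nat) (e : event) : nat :=
  match e with Cap _ => w.+2 | Cup _ => w - 2 | Cross _ _ => w end.

(** Level t lies just after the first t events. *)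
Definition strands (d : diagram) (t : nat) : nat :=
  foldl strands_after 0 (take t d).

Definition valid_event (w : nat) (e : event) : bool :=
  match e with
  | Cap p => 0 < p <= w.+1
  | Cup p | Cross p _ => 0 < p < w
  end.

Fixpoint closes (w : nat) (d : diagram) : bool :=
  if d is e :: d' then valid_event w e && closes (strands_after w e) d'
  else w == 0.

Definition valid_diagram (d : diagram) : bool := closes 0 d.

Section Regions.
Variable d : diagram.

(** Each level is cut by the strands into gaps, gap g being the one between
    positions g and g+1 (gap 0 is left of all strands, the last gap is right of
    all strands). *)
Definition gap_at : finType := {t : 'I_(size d).+1 & 'I_(strands d t).+1}.
Definition level (x : gap_at) : nat := tag x.
Definition gap (x : gap_at) : nat := tagged x.

(** [through e g h]: one can pass from gap [g] just above the event [e] to gap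
    [h] just below it without meeting the diagram. *)
Definition through (e : event) (g h : nat) : bool :=
  match e with
  | Cap p => (h == g) && (g < p) || (h == g.+2) && (p <= g.+1)
  | Cup p => (g == h) && (h < p) || (g == h.+2) && (p <= h.+1)
  | Cross p _ => (g == h) && (g != p)
  end.

Definition below : rel gap_at := fun x y =>
  (level y == (level x).+1) && through (nth (Cap 0) d (level x)) (gap x) (gap y).

(** Regions are the connected components of the complement of the diagram,
    each given as the set of its gaps. *)
Definition region (x : gap_at) : {set gap_at} :=
  [set y | connect (relU below (fun u v => below v u)) x y].

Definition regions : {set {set gap_at}} := [set region x | x : gap_at].

Definition unbounded_region : {set gap_at} := region (existT _ ord0 ord0).

(** Two gaps separated by a strand lie in regions sharing a boundary arc.  The
    shading condition is imposed across every arc, also on components without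
    crossings. *)
Definition checkerboard_shading (S : {set {set gap_at}}) : Prop :=
  [/\ S \subset regions,
      unbounded_region \notin S &
      forall x y, level x = level y -> gap y = (gap x).+1 ->
        (region x \in S) (+) (region y \in S)].

Definition is_cross (e : event) : bool := if e is Cross _ _ then true else false.

Definition crossing : finType :=
  {t : 'I_(size d) | is_cross (nth (Cap 0) d t)}.

Definition cross_pos (c : crossing) : nat :=
  if nth (Cap 0) d (val c) is Cross p _ then p else 0.

Definition cross_over (c : crossing) : bool :=
  if nth (Cap 0) d (val c) is Cross _ o then o else false.

(** The gaps around [c]: gap p just above and just below the crossing, gaps p-1
    and p+1 on its sides. *)
Definition around (c : crossing) (x : gap_at) : bool :=
  ((level x == val c) || (level x == (val c).+1)) &&
  ((cross_pos c).-1 <= gap x <= (cross_pos c).+1).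

(** The counterclockwise rotation of an over-arc from upper left to lower right
    sweeps out the two sides of the crossing, that of an over-arc from upper
    right to lower left sweeps out the gaps above and below. *)
Definition swept (c : crossing) (x : gap_at) : bool :=
  if cross_over c then gap x != cross_pos c else gap x == cross_pos c.

Definition positive_crossing (S : {set {set gap_at}}) (c : crossing) : Prop :=
  forall x, around c x -> (region x \in S) = swept c x.

Definition shaded_region (S : {set {set gap_at}}) : finType :=
  {A : {set gap_at} | A \in S}.

Definition meeting_at (S : {set {set gap_at}}) (c : crossing)
    : {set shaded_region S} :=
  [set A : shaded_region S | [exists x in val A, around c x]].

Definition checkerboard_graph (S : {set {set gap_at}}) : multigraph :=
  Multigraph (meeting_at S).

End Regions.

(** * Rational knots *)

Definition twist (i k : nat) : diagram :=
  nseq k (if odd i then Cross 2 true else Cross 1 false).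

(** At the bottom, [Cup 1] or [Cup 2] leaves two strands, at positions 1 and 2,
    which are then joined. *)
Definition rational_diagram (ns : seq nat) : diagram :=
  [:: Cap 1; Cap 3]
  ++ flatten [seq twist i.+1 (nth 0 ns i) | i <- iota 0 (size ns)]
  ++ [:: if odd (size ns) then Cup 1 else Cup 2; Cup 1].

(** * Consistency of the definitions *)

Lemma region_odd d (x y : gap_at d) :
  y \in region x -> odd (gap y) = odd (gap x).
Proof.
have below_odd u v : below u v -> odd (gap v) = odd (gap u).
  case/andP=> _; rewrite /through; case: nth => [p|p|p o].
  - by case/orP=> /andP[/eqP-> _] //=; rewrite negbK.
  - by case/orP=> /andP[/eqP-> _] //=; rewrite negbK.
  - by case/andP=> /eqP->.
rewrite inE => /connectP[s + ->]; elim: s x => //= z s IHs x /andP[xz /IHs->].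
by case/orP: xz => /below_odd.
Qed.

Lemma region_id d (x : gap_at d) : x \in region x.
Proof. by rewrite inE connect0. Qed.

Definition odd_shading d : {set {set gap_at d}} :=
  [set A in regions d | [exists x in A, odd (gap x)]].

Lemma mem_odd_shading d (x : gap_at d) :
  (region x \in odd_shading d) = odd (gap x).
Proof.
rewrite inE imset_f //=; apply/existsP/idP => [[y /andP[yx]] | odd_x].
  by rewrite (region_odd yx).
by exists x; rewrite region_id.
Qed.

Lemma odd_shadingP d : checkerboard_shading (odd_shading d).
Proof.
split=> [||x y _ xy]; first by apply/subsetP => A; rewrite inE => /andP[].
  by rewrite mem_odd_shading.
by rewrite !mem_odd_shading xy /=; case: odd.
Qed.

(** The conditions determine the shading. *)
Lemma shading_unique d (S : {set {set gap_at d}}) :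
  valid_diagram d -> checkerboard_shading S -> S = odd_shading d.
Proof.
move=> vd [sS nS altS].
have valid_nth w s i : closes w s -> i < size s ->
    exists w', valid_event w' (nth (Cap 0) s i).
  elim: s w i => //= e s IHs w [|i] /andP[ve cs]; first by exists w.
  by rewrite ltnS; apply: IHs cs.
have gap0 t (lt_t : t < (size d).+1) :
    region (existT _ (Ordinal lt_t) ord0 : gap_at d) = unbounded_region d.
  have symE : connect_sym (relU (@below d) (fun u v => below v u)).
    by apply: sym_connect_sym => u v; rewrite /= orbC.
  elim: t lt_t => [|t IHt] lt_t.
    by congr region; rewrite (_ : Ordinal lt_t = ord0) //; apply: val_inj.
  rewrite -(IHt (ltnW lt_t)); apply/setP=> y; rewrite !inE.
  symmetry; apply: (same_connect symE).
  apply: connect1; apply/orP; left; rewrite /below /level /= eqxx /= /gap /=.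
  have [w'] := valid_nth _ _ t vd lt_t.
  case: nth => [p|p|p o] /= /andP[p0 _]; rewrite ?eqxx ?p0 //.
  by rewrite eq_sym -lt0n.
have regS x : (region x \in S) = odd (gap x).
  case: x => [[t lt_t] [g lt_g]]; rewrite /gap /=.
  elim: g lt_g => [|g IHg] lt_g.
    rewrite (_ : Ordinal lt_g = ord0); last exact: val_inj.
    by rewrite gap0 (negbTE nS).
  have := altS (existT _ (Ordinal lt_t) (Ordinal (ltnW lt_g)))
               (existT _ (Ordinal lt_t) (Ordinal lt_g)) erefl erefl.
  by rewrite IHg /=; case: odd; case: (_ \in S).
apply/setP=> A; apply/idP/idP => AS.
  by have /imsetP[x _ defA] := subsetP sS A AS; move: AS; rewrite defA regS mem_odd_shading.
move: (AS); rewrite inE => /andP[/imsetP[x _ defA] _].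
by move: AS; rewrite defA regS mem_odd_shading.
Qed.

Lemma valid_rational ns : valid_diagram (rational_diagram ns).
Proof.
rewrite /valid_diagram /=; elim: (iota 0 _) => [|i s IHs] /=; first by case: odd.
rewrite -catA /twist; case: ifP => _; by elim: (nth 0 ns i).
Qed.

Lemma rational_positive ns (S : {set {set gap_at (rational_diagram ns)}}) :
  checkerboard_shading S -> forall c, positive_crossing S c.
Proof.
move=> /(shading_unique (valid_rational ns)) -> [t xt] x.
rewrite /around /swept /cross_pos /cross_over mem_odd_shading /=.
have: nth (Cap 0) (rational_diagram ns) t = Cross 2 true \/
      nth (Cap 0) (rational_diagram ns) t = Cross 1 false.
  move: xt; set d := (X in nth _ X); pose ok e := ~~ is_cross e \/
    (e = Cross 2 true \/ e = Cross 1 false).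
  have okcat a b : (forall i, ok (nth (Cap 0) a i)) ->
      (forall i, ok (nth (Cap 0) b i)) -> forall i, ok (nth (Cap 0) (a ++ b) i).
    by move=> oka okb i; rewrite nth_cat; case: ifP.
  have oknil i : ok (nth (Cap 0) [::] i) by rewrite nth_nil; left.
  suff /(_ t) : forall i, ok (nth (Cap 0) d i) by case=> [/negbTE->|].
  apply: (okcat [:: Cap 1; Cap 3]); first by move=> [|[|i]]; [left|left|exact: oknil].
  apply: (okcat _ _); last first.
    by move=> [|[|i]]; [left; case: odd|left|exact: oknil].
  elim: (iota _ _) => [|i s IHs] //=; apply: okcat => //.
  move=> j; rewrite nth_nseq; case: ifP => _; last by left.
  by right; case: odd; [left | right].
case=> -> /andP[_]; first by case: (gap x) => [|[|[|[|]]]].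
by case: (gap x) => [|[|[|]]].
Qed.

(* Main.v *)
Require Import Defs.
From mathcomp Require Import all_boot zify.

Set Implicit Arguments.
Unset Strict Implicit.
Unset Printing Implicit Defensive.

(** The checkerboard graph of a rational diagram is a series-parallel network.
    Where the diagram has four strands, the shaded gaps are gap 1 and gap 3; let
    a and b be the vertices of the regions through them.  Reading downwards, a
    crossing between positions 2 and 3 adds an edge in parallel between a and b,
    while a crossing between positions 1 and 2 adds an edge in series: it hangs a
    new vertex on a, and that vertex takes over the role of a.  The closure at
    the bottom leaves a and b distinct for odd N and identifies them for even N.

    Let t and s be the numbers of spanning trees of the network read so far,
    with a and b kept apart, respectively identified.  Deleting and contracting
    the last edge shows that a parallel edge turns (t, s) into (t + s, s) and a
    series edge turns it into (t, s + t).  Hence a twist of n crossings adds n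
    times one number to the other, T(N) is the number that the N-th twist has
    just updated, and the other one is T(N-1): this is the recurrence.

    A spanning tree is a connected edge set all of whose edges are needed for
    connectedness ([spanning_trees_critical]), so trees can be counted once it is
    known which edge sets F connect the graph.  That is decided by running a
    finite automaton over the crossings, whose two bits say whether F joins
    every vertex read so far to a or b, and whether F joins a to b ([status]);
    [card_critical] is deletion-contraction for this automaton.

    A graph is connected when its invariant 2-colourings are constant
    ([connectedP]).  A colouring of the shaded regions amounts to the sequence of
    the colours of gaps 1 and 3 at the successive levels, subject to one local
    condition per crossing ([colouring]); comparing such sequences with the
    automaton yields [connected_two_bridge]. *)

(** * Spanning trees as critical connected edge sets *)

(** When [P] is closed under supersets, these are its minimal sets; deleting one
    edge at a time keeps the recursion on edges simple. *)
Definition critical (E : finType) (P : pred {set E}) (F : {set E}) : bool :=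
  P F && [forall e in F, ~~ P (F :\ e)].

Section Trees.
Variable G : multigraph.
Implicit Types (F : {set edge G}) (u v : vertex G) (e : edge G).

Lemma connect_joinedC F : connect_sym (joined F).
Proof. by apply: sym_connect_sym => u v; rewrite /joined setUC. Qed.

(** Connectedness as the absence of a nontrivial cut.  Colourings need no choice
    of paths, and they can be examined level by level in a diagram. *)
Lemma connectedP F :
  connected F <-> 0 < #|vertex G| /\
    forall f : vertex G -> bool, (forall u v, joined F u v -> f u = f v) ->
    forall u v, f u = f v.
Proof.
split=> [/andP[-> /forallP cF] | [V0 colF]].
  split=> // f fF u v; have /forallP/(_ v)/connectP[p + ->] := cF u.
  by elim: p u => //= w p IHp u /andP[/fF-> /IHp].
rewrite /connected V0; apply/forallP=> u; apply/forallP=> v.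
rewrite -(colF (connect (joined F) u) _ u v) ?connect0 // => x y xy.
rewrite !(connect_joinedC F u); apply: same_connect; first exact: connect_joinedC.
exact: connect1.
Qed.

(** Edges can be chosen along a simple path so as to be distinct: each of them
    contains the vertex it leaves, which later edges avoid.  The conclusion is
    arranged so that an edge [e] at the last vertex of the path, seen from the
    entry [x] before its first vertex, closes it into a cycle. *)
Lemma path_edges F u (p : seq (vertex G)) :
  path (joined F) u p -> uniq (u :: p) ->
  exists c : seq (vertex G * edge G),
    [/\ unzip1 c = belast u p, uniq (unzip2 c),
        {in unzip2 c, forall e, (e \in F) /\ ends e \subset u :: p} &
        forall x e, ends x.2 = [set x.1; u] ->
          path (fun x y => ends x.2 == [set x.1; y.1]) x (rcons c (last u p, e))].
Proof.
elim: p u => [|w p IHp] u /=.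
  by move=> _ _; exists [::]; split=> //= x e ->; rewrite eqxx.
case/andP=> /existsP[e1 /andP[e1F /eqP e1uw]] pwp /andP[uwp Uwp].
have [c [c1 Uc cF cP]] := IHp w pwp Uwp.
exists ((u, e1) :: c); split=> /=; first by rewrite c1.
- rewrite Uc andbT; apply/negP=> /cF[_ /subsetP/(_ u)].
  by rewrite e1uw !inE eqxx /= => /(_ isT) uw; rewrite inE uw in uwp.
- move=> e; rewrite inE => /orP[/eqP-> | /cF[eF se]]; split=> //.
    by rewrite e1uw; apply/subsetP=> x; rewrite !inE => /orP[]/eqP->; rewrite eqxx ?orbT.
  by apply: subset_trans se _; apply/subsetP=> x; rewrite !inE => ->; rewrite orbT.
by move=> x e ->; rewrite eqxx /=; apply: cP.
Qed.

Lemma cycle_connect F (x y : vertex G * edge G) c :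
  {subset unzip2 c <= F} ->
  path (fun x y => ends x.2 == [set x.1; y.1]) x (rcons c y) ->
  exists2 w, ends x.2 = [set x.1; w] & connect (joined F) w y.1.
Proof.
elim: c x => [|z c IHc] x /= cF; first by case/andP=> /eqP-> _; exists y.1.
case/andP=> /eqP-> /IHc[e ec | w ezw wy]; first by rewrite cF // inE ec orbT.
exists z.1 => //; apply: connect_trans wy; apply: connect1; apply/existsP.
by exists z.2; rewrite ezw eqxx cF ?inE ?eqxx.
Qed.

(** An edge whose ends remain joined without it closes a cycle, and the first
    edge of a cycle is such an edge.  Taking [u = v] excludes loops. *)
Lemma acyclic_bridges F :
  acyclic F <->
  forall e u v, e \in F -> ends e = [set u; v] -> ~~ connect (joined (F :\ e)) u v.
Proof.
split=> [/acyclicP acF e u v eF euv | brF].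
  apply/negP=> /connectP[p0 /shortenP[p pp Up _] def_v].
  have [c [c1 Uc cF cP]] := path_edges pp Up.
  have /negP[] := acF ((v, e) :: c); rewrite /graph_cycle /= Uc eF /=.
  apply/and4P; split=> //.
  - move: Up; rewrite lastI rcons_uniq -def_v c1 => /andP[-> ->] //.
  - by rewrite andbT; apply/negP => /cF[]; rewrite !inE eqxx.
  - by apply/allP=> e1 /cF[]; rewrite inE => /andP[].
  - by rewrite /= def_v; apply: cP => /=; rewrite -def_v setUC.
apply/acyclicP=> [[|x c]] //; rewrite /graph_cycle.
apply/negP=> /and5P[_ _ /= /andP[xc _] /andP[xF cF] cyc].
have [|w exw wx] := cycle_connect (F := F :\ x.2) _ cyc.
  move=> e ec; have eF : e \in F := allP cF e ec; rewrite !inE eF andbT.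
  by apply: contraNneq xc => <-.
by have /negP[] := brF x.2 w x.1 xF (etrans exw (setUC _ _)).
Qed.

(** In a connected graph, deleting an edge preserves connectedness exactly when
    its ends remain joined, that is, when the edge lies on a cycle.  Every edge
    must have ends: an edge with none, or with three, could be added to a tree
    without creating a cycle. *)
Lemma spanning_trees_critical :
  (forall e, exists u v, ends e = [set u; v]) ->
  spanning_trees G = [set F | critical (@connected G) F].
Proof.
move=> ends2; apply/setP=> F; rewrite !inE /critical.
case cF: (connected F) => //=; apply/idP/'forall_implyP => [acF e eF | crF].
  have [u [v euv]] := ends2 e; have brF := acyclic_bridges F; apply/negP=> /andP[_].
  by move/forallP/(_ u)/forallP/(_ v); apply/negP; apply brF.
apply/acyclic_bridges=> e u v eF euv; apply/negP=> cuv.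
have /negP[] := crF e eF; have [V0 /forallP cF'] := andP cF.
rewrite /connected V0; apply/forallP=> x; apply/forallP=> y.
have /forallP/(_ y) := cF' x; apply: connect_sub => {}x {}y /existsP[e1].
case/andP=> e1F /eqP e1xy; have [De1 | nee1] := eqVneq e1 e; last first.
  by apply: connect1; apply/existsP; exists e1; rewrite !inE nee1 e1F e1xy eqxx.
have xy: [set x; y] = [set u; v] by rewrite -e1xy De1.
have: x \in [set u; v] by rewrite -xy !inE eqxx.
have: y \in [set u; v] by rewrite -xy !inE eqxx orbT.
have: u \in [set x; y] by rewrite xy !inE eqxx.
have: v \in [set x; y] by rewrite xy !inE eqxx orbT.
rewrite !inE.
move=> vxy uxy /orP[]/eqP Dy /orP[]/eqP Dx; subst x y; rewrite ?connect0 //.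
by rewrite connect_joinedC.
Qed.

End Trees.

(** * Counting trees of a series-parallel network *)

(** The state after some crossings has the bits: every vertex is joined to one of
    the terminals a and b; a is joined to b.  A crossing is given by its kind
    ([true] for a parallel edge, [false] for a series edge) and by whether its
    edge is kept.  Dropping a series edge leaves the old a no access to the new
    one, so it must then have been joined to b. *)
Definition extend (s x : bool * bool) : bool * bool :=
  if x.1 then (s.1, s.2 || x.2) else (s.1 && (s.2 || x.2), s.2 && x.2).

Definition status (w : seq (bool * bool)) : bool * bool :=
  foldl extend (true, false) w.

(** [spans] is connectedness after the identification of the two terminals, and
    [joins] is connectedness of the network itself. *)
Definition spans w := (status w).1.
Definition joins w := (status w).1 && (status w).2.

Lemma status_rcons w x : status (rcons w x) = extend (status w) x.
Proof. by rewrite /status foldl_rcons. Qed.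

(** Deletion-contraction on the numbers of spanning trees of the network, with
    its terminals kept apart and identified. *)
Definition extend_counts (ts : nat * nat) (par : bool) : nat * nat :=
  if par then (ts.1 + ts.2, ts.2) else (ts.1, ts.2 + ts.1).

Section Counting.
Variables (E : finType) (par : E -> bool).
Implicit Types (es : seq E) (F : {set E}).

Definition trace es F := [seq (par e, e \in F) | e <- es].

Lemma trace_rcons es e F :
  trace (rcons es e) F = rcons (trace es F) (par e, e \in F).
Proof. exact: map_rcons. Qed.

Lemma eq_trace es F F' : {in es, F =i F'} -> trace es F = trace es F'.
Proof. by move=> eqF; apply/eq_in_map=> e /eqF->. Qed.


Lemma trace_setD1 es e F : e \notin es -> trace es (F :\ e) = trace es F.
Proof.
move=> nes; apply: eq_trace => e1 e1es; rewrite !inE.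
by rewrite (_ : e1 != e) //; apply: contraNneq nes => <-.
Qed.

Lemma trace_setU1 es e F : e \notin es -> trace es (e |: F) = trace es F.
Proof.
move=> nes; apply: eq_trace => e1 e1es; rewrite !inE.
by rewrite (negbTE (_ : e1 != e)) //; apply: contraNneq nes => <-.
Qed.

(** A connected network has a path between its terminals, and one edge of that
    path becomes superfluous once they are identified.  Thus no set is both a
    spanning tree and a spanning tree after identification, which makes the
    exclusion [~~ joins] harmless in [card_critical]. *)
Lemma joins_redundant es F :
  uniq es -> joins (trace es F) -> exists2 e, e \in F & spans (trace es (F :\ e)).
Proof.
elim/last_ind: es => [|es e IHes] //; rewrite rcons_uniq => /andP[nes Ues].
rewrite /joins /spans trace_rcons status_rcons /extend /=.
have remove_e : e \in F -> (status (trace es F)).1 ->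
    (~~ par e -> (status (trace es F)).2) ->
    exists2 e1, e1 \in F & (status (trace (rcons es e) (F :\ e1))).1.
  move=> eF sF lF; exists e => //; rewrite trace_rcons status_rcons trace_setD1 //.
  by rewrite /extend /= !inE eqxx /= orbF; case: ifP lF => [//|_ /(_ isT) ->]; rewrite sF.
case: ifP remove_e => pe remove_e /=; [case/andP=> sF | case/andP=> /andP[sF _] /andP[lF eF]].
  have [lF _ | nlF eF] := boolP (status (trace es F)).2; last exact: remove_e.
  have [|e1 e1F se1] := IHes Ues; first by rewrite /joins sF lF.
  by exists e1 => //; rewrite trace_rcons status_rcons /extend pe.
exact: remove_e.
Qed.

Lemma card_subsets_rcons es e (Q : pred {set E}) : e \notin es ->
  #|[set F : {set E} | (F \subset rcons es e) && Q F]| =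
  #|[set F : {set E} | (F \subset es) && Q F]| +
  #|[set F : {set E} | (F \subset es) && Q (e |: F)]|.
Proof.
move=> nes; pose B := [set F : {set E} | (F \subset es) && Q (e |: F)].
have not_e (F : {set E}) : F \subset es -> e \notin F.
  by move/subsetP=> sF; apply: contra nes => /sF.
have injB : {in B &, injective (fun F => e |: F)}.
  move=> F1 F2; rewrite !inE => /andP[/not_e nF1 _] /andP[/not_e nF2 _] eqF.
  by rewrite -(setU1K nF1) eqF setU1K.
rewrite -(card_in_imset injB) -cardsUI.
rewrite [X in _ = _ + X](_ : _ = 0); last first.
  apply/eqP; rewrite cards_eq0; apply/eqP/setP=> F; rewrite !inE.
  apply/negP=> /andP[/andP[/not_e nF _] /imsetP[F1 _ DF]].
  by rewrite DF !inE eqxx in nF.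
rewrite addn0; apply: eq_card=> F; rewrite !inE.
apply/andP/orP=> [[sF QF] | [/andP[sF QF] | /imsetP[F1 + ->]]].
- have [eF | neF] := boolP (e \in F); last first.
    left; rewrite QF andbT; apply/subsetP=> x xF; have := subsetP sF x xF.
    by rewrite mem_rcons inE => /orP[/eqP De | //]; rewrite -De xF in neF.
  right; apply/imsetP; exists (F :\ e); last by rewrite setD1K.
  rewrite inE setD1K // QF andbT; apply/subsetP=> x; rewrite !inE => /andP[nxe xF].
  by have := subsetP sF x xF; rewrite mem_rcons inE (negbTE nxe).
- split=> //; apply: subset_trans sF _.
  by apply/subsetP=> x xes; rewrite mem_rcons inE xes orbT.
- rewrite inE => /andP[sF QF]; split=> //; apply/subsetP=> x.
  by rewrite mem_rcons !inE => /orP[->//|/(subsetP sF)->]; rewrite orbT.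
Qed.

Definition critical_traces (P : pred (seq (bool * bool))) es : {set {set E}} :=
  [set F : {set E} | (F \subset es) && critical (fun F => P (trace es F)) F].

(** Deletion and contraction of the last edge [e] for an arbitrary property [P] of
    words: [Q0] is what [P] becomes when [e] is dropped, [Q1] when it is kept.
    With [e] in the set, its being needed is the failure of [Q0]. *)
Lemma critical_extend (P Q0 Q1 : pred (seq (bool * bool))) es e F :
  F \subset es -> e \notin es ->
  (forall F, P (rcons (trace es F) (par e, true)) = Q1 (trace es F)) ->
  (forall F, P (rcons (trace es F) (par e, false)) = Q0 (trace es F)) ->
  critical (fun F => P (trace (rcons es e) F)) F =
    critical (fun F => Q0 (trace es F)) F /\
  critical (fun F => P (trace (rcons es e) F)) (e |: F) =
    critical (fun F => Q1 (trace es F)) F && ~~ Q0 (trace es F).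
Proof.
move=> sF nes P1 P0; have neF : e \notin F by apply: contra nes => /(subsetP sF).
have trE (F1 : {set E}) : e \notin F1 -> P (trace (rcons es e) F1) = Q0 (trace es F1).
  by move=> neF1; rewrite trace_rcons (negbTE neF1) P0.
have trU (F1 : {set E}) : P (trace (rcons es e) (e |: F1)) = Q1 (trace es F1).
  by rewrite trace_rcons !inE eqxx P1 trace_setU1.
have DU e1 : e1 \in F -> (e |: F) :\ e1 = e |: F :\ e1.
  move=> e1F; rewrite setDUl; congr (_ :|: _); apply/setDidPl.
  by rewrite disjoints1 inE; apply: contraNneq neF => ->.
rewrite /critical trE // trU; split.
  by congr (_ && _); apply: eq_forallb=> e1; rewrite trE // !inE (negbTE neF) andbF.
case Q1F: (Q1 _) => //=; apply/'forall_implyP/andP=> [crF | [/'forall_implyP crF nQ] e1].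
  split; last by have := crF e; rewrite setU1K // trE // !inE eqxx; apply.
  by apply/'forall_implyP=> e1 e1F; rewrite -trU -DU // crF // !inE e1F orbT.
rewrite !inE => /orP[/eqP-> | e1F]; first by rewrite setU1K // trE.
by rewrite DU // trU crF.
Qed.

Lemma card_critical_extend (P Q0 Q1 : pred (seq (bool * bool))) es e :
  e \notin es ->
  (forall w, P (rcons w (par e, true)) = Q1 w) ->
  (forall w, P (rcons w (par e, false)) = Q0 w) ->
  #|critical_traces P (rcons es e)| = #|critical_traces Q0 es| +
    #|[set F in critical_traces Q1 es | ~~ Q0 (trace es F)]|.
Proof.
move=> nes P1 P0; rewrite {1}/critical_traces card_subsets_rcons //; congr (_ + _).
  apply: eq_card => F; rewrite !inE; case sF: (F \subset _) => //=.
  by have [] := critical_extend sF nes (fun F => P1 (trace es F)) (fun F => P0 _).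
apply: eq_card => F; rewrite !inE; case sF: (F \subset _) => //=.
by have [] := critical_extend sF nes (fun F => P1 (trace es F)) (fun F => P0 _).
Qed.

(** In two of the four cases one term of [card_critical_extend] vanishes: a parallel
    edge between identified terminals is a loop, so no tree contains it, and a
    series edge to a new terminal is pendant, so every tree contains it. *)
Lemma card_critical es : uniq es ->
  (#|critical_traces joins es|, #|critical_traces spans es|) =
  foldl extend_counts (0, 1) (map par es).
Proof.
elim/last_ind: es => [|es e IHes].
  move=> _; rewrite /=; congr (_, _).
    by apply: eq_card0 => F; rewrite !inE /critical andbF.
  rewrite -(cards1 (set0 : {set E})); apply: eq_card => F; rewrite !inE.
  apply/andP/eqP=> [[/subsetP sF _] | ->].
    by apply/setP=> e; rewrite inE; apply/negP=> /sF.
  split; first by apply/subsetP=> e; rewrite inE.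
  by apply/'forall_implyP=> e; rewrite inE.
rewrite rcons_uniq => /andP[nes Ues]; rewrite map_rcons foldl_rcons -IHes // /extend_counts.
have crit0 (Q : pred (seq (bool * bool))) :
    #|[set F in critical_traces Q es | ~~ Q (trace es F)]| = 0.
  by apply: eq_card0 => F; rewrite !inE /critical; case: (Q _); rewrite ?andbF.
have critD : #|[set F in critical_traces spans es | ~~ joins (trace es F)]| =
    #|critical_traces spans es|.
  apply: eq_card => F; rewrite !inE; apply: andb_idr => crF.
  case/and3P: crF => _ _ /'forall_implyP crF; apply/negP=> /(joins_redundant Ues)[e1 e1F].
  exact/negP/crF.
case pe: (par e) => /=; congr (_, _).
- rewrite (card_critical_extend (Q0 := joins) (Q1 := spans)) //; first by rewrite critD.
    by move=> w; rewrite /joins status_rcons pe /extend /= orbT andbT.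
  by move=> w; rewrite /joins status_rcons pe /extend /= orbF.
- rewrite (card_critical_extend (Q0 := spans) (Q1 := spans)) //; first by rewrite crit0 addn0.
    by move=> w; rewrite /spans status_rcons pe.
  by move=> w; rewrite /spans status_rcons pe.
- rewrite (card_critical_extend (Q0 := pred0) (Q1 := joins)) //.
  + rewrite [X in X + _](_ : _ = 0) ?add0n.
      by apply: eq_card => F; rewrite !inE andbT.
    by apply: eq_card0 => F; rewrite !inE /critical andbF.
  + by move=> w; rewrite /joins status_rcons pe /extend /= orbT !andbT.
  + by move=> w; rewrite /joins status_rcons pe /extend /= !andbF.
- rewrite (card_critical_extend (Q0 := joins) (Q1 := spans)) //; first by rewrite critD addnC.
    by move=> w; rewrite /spans status_rcons pe /extend /= orbT andbT.
  by move=> w; rewrite /spans status_rcons pe /extend /= orbF.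
Qed.
End Counting.

(** * Connectedness through colourings of the levels *)

(** [p] and [q] are the colours of gaps 1 and 3 above and below a crossing of kind
    [x.1].  Both regions pass beside a parallel crossing; at a series crossing
    only the region of gap 3 does.  A kept edge, [x.2], forces its two ends to
    have the same colour. *)
Definition compatible (x : bool * bool) (p q : bool * bool) : bool :=
  if x.1 then (q == p) && (x.2 ==> (p.1 == p.2))
  else (q.2 == p.2) && (x.2 ==> (q.1 == p.1)).

Definition colouring (w : seq (bool * bool)) (f : nat -> bool * bool) : Prop :=
  forall i, i < size w -> compatible (nth (false, false) w i) (f i) (f i.+1).

Lemma colouring_rcons w x f :
  colouring (rcons w x) f <->
  colouring w f /\ compatible x (f (size w)) (f (size w).+1).
Proof.
split=> [fw | [fw fx] i].
  split=> [i lt_i|]; have := fw (_ : nat); last first.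
    by move/(_ (size w)); rewrite size_rcons leqnn nth_rcons ltnn eqxx; apply.
  by move/(_ i); rewrite size_rcons nth_rcons lt_i; apply; apply: leqW.
rewrite size_rcons ltnS leq_eqVlt => /orP[/eqP-> | lt_i].
  by rewrite nth_rcons ltnn eqxx.
by rewrite nth_rcons lt_i; apply: fw.
Qed.

Lemma colouring_extend w x f q :
  colouring w f -> compatible x (f (size w)) q ->
  exists2 g, colouring (rcons w x) g &
    g (size w).+1 = q /\ forall i, i <= size w -> g i = f i.
Proof.
move=> fw fq; exists (fun i => if i <= size w then f i else q); last first.
  by rewrite ltnn; split=> // i ->.
apply/colouring_rcons; rewrite leqnn ltnn; split=> // i lt_i.
by rewrite ltnW // lt_i; apply: fw.
Qed.

Lemma colouring_links w f :
  colouring w f -> (status w).2 -> (f (size w)).1 = (f (size w)).2.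
Proof.
elim/last_ind: w f => [|w x IHw] f //; rewrite status_rcons size_rcons.
case/colouring_rcons=> /IHw fw; rewrite /compatible /extend /=; case: x.1.
  by case/andP=> /eqP-> /implyP fx /orP[/fw | /fx/eqP].
by case/andP=> /eqP-> /implyP fx /andP[/fw eqf /fx/eqP->].
Qed.

Lemma colouring_spans w f b :
  colouring w f -> (status w).1 -> f (size w) = (b, b) ->
  forall i, i <= size w -> f i = (b, b).
Proof.
elim/last_ind: w f => [|w x IHw] f; first by move=> _ _ f0 [].
rewrite status_rcons size_rcons => /colouring_rcons[fw fx] sw f1 i.
rewrite leq_eqVlt => /orP[/eqP-> // | ]; rewrite ltnS; apply: IHw => //.
  by move: sw; rewrite /extend; case: ifP => // _ /andP[].
have := colouring_links fw; move: fx sw; rewrite f1 /compatible /extend; case: x => -[] k /=.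
  by case/andP=> /eqP->.
case: (f _) => a c /=; case/andP=> /eqP<- /implyP fx /andP[_ /orP[lw /(_ lw)-> // | /fx/eqP->//]].
Qed.

(** Conversely to [colouring_links], that is the only constraint on the colours at
    the last level: a colouring is built upwards from them, and above a dropped
    series edge the colour of gap 1 is free, so it can be copied from gap 3. *)
Lemma exists_colouring w p :
  ((status w).2 -> p.1 = p.2) -> exists2 f, colouring w f & f (size w) = p.
Proof.
elim/last_ind: w p => [|w x IHw] p; first by exists (fun=> p).
rewrite status_rcons size_rcons /extend => fp.
suff [q lq qp] : exists2 q : bool * bool, (status w).2 -> q.1 = q.2 & compatible x q p.
  have [f fw fq] := IHw q lq.
  by have [|g gw [gp _]] := colouring_extend (x := x) (q := p) fw; [rewrite fq | exists g].
case: x fp => -[] k /= fp; rewrite /compatible /=.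
  exists p => [lw|]; first by apply: fp; rewrite lw.
  by rewrite eqxx; apply/implyP=> kt; apply/eqP/fp; rewrite kt orbT.
case: k fp => /= fp; last by exists (p.2, p.2) => //; rewrite eqxx.
by exists p; rewrite ?eqxx // => lw; apply: fp; rewrite lw.
Qed.

(** Conversely to [colouring_spans].  The [spans] bit is lost at a dropped series
    edge while a and b are not joined; the old a can then have a colour different
    from that of both terminals below. *)
Lemma nonconstant_colouring w : ~~ (status w).1 ->
  exists2 f, colouring w f &
    f (size w) = (false, false) /\ exists2 i, i <= size w & f i != (false, false).
Proof.
elim/last_ind: w => [|w x IHw] //; rewrite status_rcons size_rcons => nsx.
case sw: (status w).1; last first.
  have [|f fw [f0 [i le_i fi]]] := IHw; first by rewrite sw.
  have [|g gw [g0 gf]] := colouring_extend (x := x) (q := (false, false)) fw.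
    by rewrite f0 /compatible; case: x.1; rewrite /= ?eqxx implybT.
  by exists g => //; split=> //; exists i; rewrite ?gf // leqW.
case: x nsx => -[] k; rewrite /extend /= sw //= negb_or => /andP[nl nk].
have [|f fw f1] := exists_colouring (w := w) (p := (true, false)); first by rewrite (negbTE nl).
have [|g gw [g0 gf]] := colouring_extend (x := (false, k)) (q := (false, false)) fw.
  by rewrite f1 /compatible /= (negbTE nk).
by exists g => //; split=> //; exists (size w); rewrite ?gf // f1.
Qed.

(** * Gaps and regions *)

Section Points.
Variable d : diagram.
Implicit Types x y : gap_at d.

Lemma gap_at_inj x y : level x = level y -> gap x = gap y -> x = y.
Proof.
case: x y => [t g] [t' g']; rewrite /level /gap /= => /val_inj tt'.
by case: _ / tt' g' => g' /= /val_inj->.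
Qed.

(** Gaps addressed by plain numbers; outside the range of a diagram the value is
    the leftmost gap of level 0. *)
Definition point t g : gap_at d :=
  odflt (existT _ ord0 ord0) [pick x : gap_at d | (level x == t) && (gap x == g)].

Lemma point_level_gap t g : t <= size d -> g <= strands d t ->
  level (point t g) = t /\ gap (point t g) = g.
Proof.
move=> le_t le_g; rewrite /point; case: pickP => [x /andP[/eqP-> /eqP->] // |].
have lt_t : t < (size d).+1 by []; have lt_g : g < (strands d t).+1 by [].
by move/(_ (existT _ (Ordinal lt_t) (Ordinal lt_g))); rewrite /level /gap /= !eqxx.
Qed.

Lemma level_le x : level x <= size d. Proof. by rewrite -ltnS ltn_ord. Qed.
Lemma gap_le x : gap x <= strands d (level x). Proof. by rewrite -ltnS ltn_ord. Qed.

Lemma point_self x : point (level x) (gap x) = x.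
Proof. by have [lx gx] := point_level_gap (level_le x) (gap_le x); apply: gap_at_inj. Qed.

Lemma region_eq x y : y \in region x -> region y = region x.
Proof.
have symE : connect_sym (relU (@below d) (fun u v => below v u)).
  by apply: sym_connect_sym => u v; rewrite /= orbC.
rewrite inE => xy; apply/setP=> z; rewrite !inE.
by apply: (same_connect symE); rewrite symE.
Qed.

Lemma region_below x y : below x y -> region x = region y.
Proof. by move=> xy; symmetry; apply: region_eq; rewrite inE connect1 //= xy. Qed.

Lemma region_invariant (h : gap_at d -> bool) x y :
  (forall x y, below x y -> h x = h y) -> y \in region x -> h y = h x.
Proof.
move=> hP; rewrite inE => /connectP[s + ->]; elim: s x => //= z s IHs x.
by case/andP=> /orP[] /hP xz /IHs->.
Qed.

Lemma region_through t g h : t < size d -> g <= strands d t -> h <= strands d t.+1 ->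
  through (nth (Cap 0) d t) g h -> region (point t g) = region (point t.+1 h).
Proof.
move=> lt_t le_g le_h thr; apply: region_below; rewrite /below.
have [-> ->] := point_level_gap (ltnW lt_t) le_g.
by have [-> ->] := point_level_gap lt_t le_h; rewrite eqxx.
Qed.

End Points.

(** * Diagrams with two caps, crossings, and two cups *)

Definition crossing_event (par : bool) : event :=
  if par then Cross 2 true else Cross 1 false.

(** Rational diagrams with the grouping of the crossings into twists forgotten. *)
Definition two_bridge (ks : seq bool) (b : bool) : diagram :=
  [:: Cap 1; Cap 3] ++ map crossing_event ks
    ++ [:: if b then Cup 1 else Cup 2; Cup 1].

Section TwoBridge.
Variables (ks : seq bool) (b : bool).
Let d := two_bridge ks b.
Let L := size ks.
Implicit Types (x y : gap_at d).

Lemma size_two_bridge : size d = L.+4.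
Proof. by rewrite /= size_cat size_map /= addn2. Qed.

Lemma nth_crossing_event i : i < L ->
  nth (Cap 0) d i.+2 = crossing_event (nth false ks i).
Proof. by move=> lt_i; rewrite /= nth_cat size_map lt_i (nth_map false). Qed.

Lemma nth_bottom : nth (Cap 0) d L.+2 = if b then Cup 1 else Cup 2.
Proof. by rewrite /= nth_cat size_map ltnn subnn. Qed.

Lemma nth_last_cup : nth (Cap 0) d L.+3 = Cup 1.
Proof. by rewrite /= nth_cat size_map ltnNge leqnSn /= subSnn. Qed.

Lemma strandsS t : t < size d ->
  strands d t.+1 = strands_after (strands d t) (nth (Cap 0) d t).
Proof. by move=> lt_t; rewrite /strands (take_nth (Cap 0)) // foldl_rcons. Qed.

Lemma strands_middle i : i <= L -> strands d i.+2 = 4.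
Proof.
elim: i => [|i IHi] lt_i; first by rewrite 2?strandsS ?size_two_bridge.
rewrite strandsS ?size_two_bridge; last by rewrite !ltnS ltnW // ltnW.
by rewrite IHi ?(ltnW lt_i) // nth_crossing_event //; case: nth.
Qed.

Lemma strands_bottom : strands d L.+3 = 2.
Proof.
by rewrite strandsS ?size_two_bridge // strands_middle // nth_bottom; case: b.
Qed.

Lemma strands_end : strands d L.+4 = 0.
Proof. by rewrite strandsS ?size_two_bridge // strands_bottom nth_last_cup. Qed.

Lemma strands0 : strands d 0 = 0. Proof. by []. Qed.
Lemma strands1 : strands d 1 = 2. Proof. by rewrite strandsS ?size_two_bridge. Qed.

(** The shaded gaps: [i] counts the crossings above a level with four strands. *)
Variant odd_gap_spec x : Prop :=
  | OddTop of level x = 1 & gap x = 1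
  | OddMiddle i of i <= L & level x = i.+2 & (gap x = 1 \/ gap x = 3)
  | OddBottom of level x = L.+3 & gap x = 1.

Lemma odd_gapP x : odd (gap x) -> odd_gap_spec x.
Proof.
move: (gap_le x) (level_le x); rewrite size_two_bridge.
case Dt: (level x) => [|[|i]]; first by rewrite strands0; case: (gap x).
  rewrite strands1; case Dg: (gap x) => [|[|[|[]]]] // _ _ _.
  exact: OddTop.
rewrite 2!ltnS; case: (leqP i L) => [le_i | lt_i].
  rewrite strands_middle // => g4 _ og; apply: OddMiddle Dt _ => //.
  by move: g4 og; case: (gap x) => [|[|[|[|[]]]]] //; [left | right].
move=> g_le le_i og; have [Di | Di]: i = L.+1 \/ i = L.+2 by lia.
  move: g_le og; rewrite Di strands_bottom => g_le og; apply: OddBottom; rewrite ?Dt ?Di //.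
  by move: g_le og; case: (gap x) => [|[|[]]].
by move: g_le og; rewrite Di strands_end; case: (gap x).
Qed.

Definition reg t g : {set gap_at d} := region (point d t g).

Lemma region_reg x : region x = reg (level x) (gap x).
Proof. by rewrite /reg point_self. Qed.

Lemma reg_top : reg 1 1 = reg 2 1.
Proof.
by apply: region_through; rewrite ?size_two_bridge ?strands1 ?strands_middle.
Qed.

Lemma reg_step i g : i < L -> g <= 4 -> g != (if nth false ks i then 2 else 1) ->
  reg i.+2 g = reg i.+3 g.
Proof.
move=> lt_i le_g ne_g; apply: region_through; rewrite ?strands_middle ?size_two_bridge //.
- by lia.
- exact: ltnW.
by rewrite nth_crossing_event //; move: ne_g; case: nth => /= ->; rewrite eqxx.
Qed.

Lemma reg_bottom3 : reg L.+2 3 = reg L.+3 1.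
Proof.
apply: region_through; rewrite ?strands_bottom ?strands_middle ?size_two_bridge //.
by rewrite nth_bottom; case: b.
Qed.

Lemma reg_bottom1 : ~~ b -> reg L.+2 1 = reg L.+3 1.
Proof.
move=> nb; apply: region_through; rewrite ?strands_bottom ?strands_middle ?size_two_bridge //.
by rewrite nth_bottom (negbTE nb).
Qed.

Lemma odd_region x : odd (gap x) ->
  exists2 i, i <= L & region x = reg i.+2 1 \/ region x = reg i.+2 3.
Proof.
case/odd_gapP=> [tx gx | i le_i tx gx | tx gx]; rewrite region_reg tx ?gx.
- by exists 0 => //; left; rewrite reg_top.
- by exists i => //; case: gx => ->; [left | right].
- by exists L => //; right; rewrite reg_bottom3.
Qed.

(** The colour of a shaded gap under a sequence of colours.  Truncation sends
    level 1 to index 0, and the level under the first cup to index [L]; the only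
    shaded gap there belongs to the region of gap 3 above it, whence the second
    component. *)
Definition gap_colour (f : nat -> bool * bool) x : bool :=
  let p := f (minn (level x - 2) L) in
  odd (gap x) && (if (gap x == 1) && (level x <= L.+2) then p.1 else p.2).

(** For [b = false] the first cup merges the regions of gaps 1 and 3, which must
    therefore end with the same colour. *)
Lemma gap_colour_below (w : seq (bool * bool)) f x y :
  map fst w = ks -> colouring w f -> (~~ b -> (f L).1 = (f L).2) ->
  below x y -> gap_colour f x = gap_colour f y.
Proof.
move=> Dks fw fb /andP[/eqP lxy thr]; move: thr.
have Dg : through (nth (Cap 0) d (level x)) (gap x) (gap y) -> odd (gap y) = odd (gap x).
  case: nth => [p|p|p o] /=; first by case/orP=> /andP[/eqP-> _] //=; rewrite negbK.
    by case/orP=> /andP[/eqP-> _] //=; rewrite negbK.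
  by case/andP=> /eqP->.
move=> thr; rewrite /gap_colour (Dg thr); case ox: (odd (gap x)) => //=.
have oy : odd (gap y) by rewrite Dg.
have szw : size w = L by rewrite -(size_map fst) Dks.
case: (odd_gapP ox) thr => [tx gx | i le_i tx gx | tx gx].
- rewrite lxy tx gx min0n /= => /orP[/andP[/eqP->]|/andP[_]] //=.
- have [lt_i | ] := ltnP i L; last first.
    move=> ge_i; have {ge_i}Di : i = L by apply/eqP; rewrite eqn_leq le_i.
    rewrite lxy tx Di nth_bottom !subSS subn0 minnn (minn_idPr (leqnSn _)) ltnn andbF leqnn andbT.
    have [_ | /fb->] := boolP b; last by case: ifP.
    by case: gx => -> //= /orP[/andP[/eqP<-] | ].
  rewrite lxy tx nth_crossing_event // !subSS !subn0 (minn_idPl le_i) (minn_idPl lt_i).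
  rewrite !ltnS le_i lt_i !andbT.
  have := fw i; rewrite szw lt_i => /(_ isT); rewrite /compatible -Dks.
  rewrite (nth_map (false, false)) ?szw //; case: (nth _ w i) => [[] k] /=.
    by case/andP=> /eqP-> _ /andP[/eqP-> _].
  by case/andP=> /eqP-> _; case: gx => -> /andP[/eqP<-].
by rewrite tx gx nth_last_cup /= => /orP[/andP[/eqP<-] | ].
Qed.

(** * The checkerboard graph as a series-parallel network *)

Notation S := (odd_shading d).
Notation G := (checkerboard_graph S).

Lemma mem_reg i g : i <= L -> g <= 4 -> odd g -> reg i.+2 g \in S.
Proof.
move=> le_i le_g og; rewrite mem_odd_shading.
have [|| _ ->//] := @point_level_gap d i.+2 g; last by rewrite strands_middle.
by rewrite size_two_bridge !ltnS ltnW // ltnW.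
Qed.

(** [i] is the number of crossings above; the two caps account for the shift. *)
Definition node i g : vertex G :=
  insubd (Sub (reg 2 1) (mem_reg (leq0n L) (isT : 1 <= 4) isT)) (reg i.+2 g).

Lemma val_node i g : i <= L -> g <= 4 -> odd g -> val (node i g) = reg i.+2 g.
Proof. by move=> le_i le_g og; rewrite insubdK //; apply: mem_reg. Qed.

Lemma vertex_region (u : vertex G) x : x \in val u -> val u = region x /\ odd (gap x).
Proof.
have := valP u; rewrite inE => /andP[/imsetP[y _ Du] ou] xu.
have Dr : region x = region y by apply: region_eq; rewrite -Du.
by rewrite Du Dr -mem_odd_shading Dr -Du (valP u).
Qed.

Lemma nodeP (u : vertex G) : exists2 i, i <= L & u = node i 1 \/ u = node i 3.
Proof.
have [x xu] : exists x, x \in val u.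
  by have := valP u; rewrite inE => /andP[_ /existsP[x /andP[xu _]]]; exists x.
have [Du ox] := vertex_region xu; have [i le_i ui] := odd_region ox.
by exists i => //; case: ui => ui; [left | right]; apply: val_inj; rewrite val_node // Du.
Qed.

Lemma crossing_subproof (i : 'I_L) :
  {lt_i : i.+2 < size d | is_cross (nth (Cap 0) d (Ordinal lt_i))}.
Proof.
have lt_i : i.+2 < size d by have := ltn_ord i; rewrite size_two_bridge; lia.
by exists lt_i; rewrite nth_crossing_event //; case: nth.
Qed.

Definition twist_crossing (i : 'I_L) : crossing d :=
  let: exist lt_i xi := crossing_subproof i in exist _ (Ordinal lt_i) xi.

Lemma val_twist_crossing i : val (val (twist_crossing i)) = i.+2.
Proof. by rewrite /twist_crossing; case: crossing_subproof. Qed.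

Lemma twist_crossing_inj : injective twist_crossing.
Proof.
by move=> i j /(congr1 (fun c => val (val c))); rewrite !val_twist_crossing => -[/val_inj].
Qed.

Lemma crossing_level t :
  t < size d -> is_cross (nth (Cap 0) d t) -> 1 < t < L.+2.
Proof.
rewrite size_two_bridge => lt_t; apply: contraTT => out_t.
have [|[|[|]]] : t = 0 \/ t = 1 \/ t = L.+2 \/ t = L.+3 by lia.
- by move=> ->.
- by move=> ->.
- by move=> ->; rewrite nth_bottom; case: b.
- by move=> ->; rewrite nth_last_cup.
Qed.

Lemma twist_crossing_surj c : exists i, c = twist_crossing i.
Proof.
have lt_c := crossing_level (ltn_ord (val c)) (valP c).
have lt_i : (val (val c)).-2 < L.
  by move: lt_c => /=; case: (nat_of_ord (sval c)) => [|[|t]].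
exists (Ordinal lt_i); do 2!apply: val_inj; rewrite val_twist_crossing.
by move: lt_c => /=; case: (nat_of_ord (sval c)) => [|[|t]].
Qed.

Definition par_crossing (c : crossing d) : bool := nth false ks (val (val c) - 2).

Lemma par_twist_crossing i : par_crossing (twist_crossing i) = nth false ks i.
Proof. by rewrite /par_crossing val_twist_crossing !subSS subn0. Qed.

Lemma ends_twist_crossing (i : 'I_L) :
  @ends G (twist_crossing i) =
    [set node i 1; if nth false ks i then node i 3 else node i.+1 1].
Proof.
have lt_i := ltn_ord i; have le_i := ltnW lt_i.
have Dpos : cross_pos (twist_crossing i) = if nth false ks i then 2 else 1.
  by rewrite /cross_pos val_twist_crossing nth_crossing_event //; case: nth.
have aroundP x : odd (gap x) -> around (twist_crossing i) x ->
    region x \in [set reg i.+2 1; if nth false ks i then reg i.+2 3 else reg i.+3 1].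
  rewrite /around Dpos val_twist_crossing region_reg !inE => ox /andP[].
  have e1 := @reg_step i 1 lt_i isT; have e3 := @reg_step i 3 lt_i isT.
  move: ox e1 e3; case: nth => /= ox e1 e3 /orP[]/eqP-> //.
  - by case: (gap x) ox => [|[|[|[|]]]] // *; rewrite eqxx ?orbT.
  - by case: (gap x) ox => [|[|[|[|]]]] // *; rewrite -?e1 -?e3 // eqxx ?orbT.
  - by case: (gap x) ox => [|[|[|[|]]]] // *; rewrite eqxx ?orbT.
  - by case: (gap x) ox => [|[|[|[|]]]] // *; rewrite eqxx ?orbT.
have meets j g : i <= j <= i.+1 -> j <= L -> g <= 4 -> odd g ->
    (if nth false ks i then 2 else 1).-1 <= g <= (if nth false ks i then 2 else 1).+1 ->
    [exists x in val (node j g), around (twist_crossing i) x].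
  move=> ij le_j le_g og gi; apply/existsP; exists (point d j.+2 g).
  rewrite val_node // region_id /around Dpos val_twist_crossing.
  have [||-> ->] := @point_level_gap d j.+2 g; last by rewrite gi andbT !eqSS; lia.
    by rewrite size_two_bridge !ltnS ltnW // ltnW.
  by rewrite strands_middle.
apply/setP=> u; rewrite inE; apply/existsP/idP => [[x /andP[xu]] | ].
  have [Du ox] := vertex_region xu.
  move/(aroundP x ox); rewrite -Du !inE -!(inj_eq val_inj) val_node //.
  by case: ifP => _; rewrite val_node.
move=> ui; apply/existsP; move: ui.
by rewrite !inE; case Di: nth => /orP[]/eqP->; apply: meets; rewrite ?leqnn ?leqnSn ?Di.
Qed.

Definition twist_crossings : seq (crossing d) := codom twist_crossing.

Lemma mem_twist_crossings c : c \in twist_crossings.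
Proof. by have [i ->] := twist_crossing_surj c; apply: codom_f. Qed.

Lemma uniq_twist_crossings : uniq twist_crossings.
Proof. by rewrite map_inj_uniq ?enum_uniq //; apply: twist_crossing_inj. Qed.

Lemma size_twist_crossings : size twist_crossings = L.
Proof. by rewrite size_codom card_ord. Qed.

Lemma map_par_crossings : map par_crossing twist_crossings = ks.
Proof.
apply: (@eq_from_nth _ false) => [|i]; rewrite size_map size_twist_crossings // => lt_i.
rewrite (nth_map (twist_crossing (Ordinal lt_i))) ?size_twist_crossings //.
rewrite (nth_map (Ordinal lt_i)) ?size_enum_ord // par_twist_crossing.
by rewrite nth_enum_ord.
Qed.

Notation word := (trace par_crossing twist_crossings).

Lemma size_word F : size (word F) = L.
Proof. by rewrite size_map size_twist_crossings. Qed.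

Lemma nth_word F (i : 'I_L) :
  nth (false, false) (word F) i = (nth false ks i, twist_crossing i \in F).
Proof.
rewrite (nth_map (twist_crossing i)) ?size_twist_crossings //.
by rewrite (nth_map i) ?size_enum_ord // nth_ord_enum par_twist_crossing.
Qed.

Implicit Types F : {set edge G}.

Lemma joined_invariant F (f : vertex G -> bool) :
  (forall u v, joined F u v -> f u = f v) <->
  (forall i : 'I_L, twist_crossing i \in F ->
    f (node i 1) = f (if nth false ks i then node i 3 else node i.+1 1)).
Proof.
split=> [fF i iF | fF u v /existsP[c /andP[cF /eqP Dc]]].
  by apply: fF; apply/existsP; exists (twist_crossing i); rewrite iF ends_twist_crossing eqxx.
have [i Di] := twist_crossing_surj c; subst c.
have fE w : w \in [set u; v] -> f w = f (node i 1).
  by rewrite -Dc ends_twist_crossing !inE => /orP[]/eqP-> //; rewrite fF.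
by rewrite !fE // !inE eqxx ?orbT.
Qed.

Lemma node_step i g : i < L -> odd g -> g <= 4 -> g != (if nth false ks i then 2 else 1) ->
  node i g = node i.+1 g.
Proof.
move=> lt_i og le_g ne_g; apply: val_inj.
by rewrite (val_node (ltnW lt_i)) // (val_node lt_i) // reg_step.
Qed.

Lemma colouring_of_vertices F (f : vertex G -> bool) :
  (forall u v, joined F u v -> f u = f v) ->
  colouring (word F) (fun i => (f (node i 1), f (node i 3))).
Proof.
move/joined_invariant=> fF i; rewrite size_word => lt_i.
have := fF (Ordinal lt_i); rewrite (nth_word F (Ordinal lt_i)) /compatible /=.
have e1 := @node_step i 1 lt_i isT isT; have e3 := @node_step i 3 lt_i isT isT.
move: e1 e3; case: nth => /= e1 e3 fi.
  by rewrite -e1 // -e3 // eqxx; apply/implyP=> /fi->.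
by rewrite -e3 // eqxx; apply/implyP=> /fi->.
Qed.

Definition vertex_colour (f : nat -> bool * bool) (u : vertex G) : bool :=
  [exists x in val u, gap_colour f x].

Lemma vertex_colour_node F f i :
  colouring (word F) f -> (~~ b -> (f L).1 = (f L).2) -> i <= L ->
  vertex_colour f (node i 1) = (f i).1 /\ vertex_colour f (node i 3) = (f i).2.
Proof.
move=> fw fb le_i.
have colourE g : odd g -> g <= 4 ->
    vertex_colour f (node i g) = if g == 1 then (f i).1 else (f i).2.
  move=> og le_g; have [||lp gp] := @point_level_gap d i.+2 g.
  - by rewrite size_two_bridge !ltnS ltnW // ltnW.
  - by rewrite strands_middle.
  have Dp : gap_colour f (point d i.+2 g) = if g == 1 then (f i).1 else (f i).2.
    by rewrite /gap_colour lp gp og !subSS subn0 (minn_idPl le_i) !ltnS le_i andbT.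
  have inv : {in region (point d i.+2 g), forall y,
      gap_colour f y = gap_colour f (point d i.+2 g)}.
    move=> y; apply: region_invariant => x z; apply: gap_colour_below fw fb.
    by rewrite -map_par_crossings -map_comp.
  rewrite -Dp /vertex_colour val_node //; apply/existsP/idP => [[y /andP[yr]] | cp].
    by rewrite inv.
  by exists (point d i.+2 g); rewrite region_id.
by rewrite !colourE.
Qed.

Lemma vertex_colour_invariant F f :
  colouring (word F) f -> (~~ b -> (f L).1 = (f L).2) ->
  forall u v, joined F u v -> vertex_colour f u = vertex_colour f v.
Proof.
move=> fw fb; apply/joined_invariant=> i iF.
have := fw i; rewrite size_word ltn_ord => /(_ isT); rewrite nth_word iF /compatible /=.
have [-> Di3] := vertex_colour_node fw fb (ltnW (ltn_ord i)).
have [Di1 _] := vertex_colour_node fw fb (ltn_ord i).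
by case: nth => /= /andP[_ /eqP]; rewrite ?Di3 ?Di1.
Qed.

(** If [b] holds, the terminals stay distinct at the bottom; otherwise they are
    identified there, and joining all vertices to one of them is enough. *)
Lemma connected_two_bridge F :
  connected F = if b then joins (word F) else spans (word F).
Proof.
have node_bottom : ~~ b -> node L 1 = node L 3.
  by move=> nb; apply: val_inj; rewrite !val_node // reg_bottom1 // reg_bottom3.
apply/idP/idP => [/connectedP[_ cF] | stF].
  have constant f : colouring (word F) f -> (~~ b -> (f L).1 = (f L).2) ->
      forall i, i <= L -> f i = f L /\ (f L).1 = (f L).2.
    move=> fw fb i le_i; have fV := cF _ (vertex_colour_invariant fw fb).
    have [Di1 Di3] := vertex_colour_node fw fb le_i.
    have [DL1 DL3] := vertex_colour_node fw fb (leqnn L).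
    rewrite [f i]surjective_pairing -Di1 -Di3 -DL1 -DL3 [RHS]surjective_pairing.
    by rewrite -DL1 -DL3 !(fV _ (node L 1)).
  have sF : spans (word F).
    apply: contraT => /nonconstant_colouring[f fw]; rewrite size_word => -[f0 [i le_i]].
    by have [|-> _] := constant f fw _ i le_i; rewrite f0 ?eqxx.
  have [bT|//] := boolP b; rewrite /joins; apply/andP; split=> //; apply: contraT => nl.
  have [|f fw] := @exists_colouring (word F) (true, false); first by rewrite (negbTE nl).
  rewrite size_word => fL; have [|_] := constant f fw _ L (leqnn L); last by rewrite fL.
  by rewrite bT.
apply/connectedP; split=> [|f fF u v]; first by apply/card_gt0P; exists (node 0 1).
have fw := colouring_of_vertices fF.
have sF : spans (word F) by move: stF; case: b => // /andP[].
have fL : f (node L 3) = f (node L 1).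
  have [bT | nb] := boolP b; last by rewrite node_bottom.
  move: stF; rewrite bT => /andP[_ lF]; have := colouring_links fw lF.
  by rewrite size_word.
suff fE w : f w = f (node L 1) by rewrite !fE.
have [i le_i wi] := nodeP w; have := colouring_spans (b := f (node L 1)) fw sF.
by rewrite size_word fL => /(_ erefl i le_i)[]; case: wi => ->.
Qed.

Lemma card_spanning_trees_two_bridge :
  let ts := foldl extend_counts (0, 1) ks in
  #|spanning_trees G| = if b then ts.1 else ts.2.
Proof.
rewrite spanning_trees_critical => [|c]; last first.
  have [i ->] := twist_crossing_surj c; rewrite ends_twist_crossing.
  by do 2!eexists.
have := card_critical par_crossing uniq_twist_crossings; rewrite map_par_crossings => <- /=.
rewrite (_ : [set F | _] =
    critical_traces par_crossing (if b then joins else spans) twist_crossings).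
  by case: b.
apply/setP=> F; rewrite !inE (_ : F \subset _) /=; last first.
  by apply/subsetP=> c _; apply: mem_twist_crossings.
rewrite /critical connected_two_bridge; congr (_ && _); first by case: b.
by apply: eq_forallb => c; rewrite connected_two_bridge; case: b.
Qed.

End TwoBridge.

(** * Rational diagrams *)

Definition twist_kinds (ns : seq nat) : seq bool :=
  flatten [seq nseq (nth 0 ns i) (odd i.+1) | i <- iota 0 (size ns)].

Lemma rational_two_bridge ns :
  rational_diagram ns = two_bridge (twist_kinds ns) (odd (size ns)).
Proof.
rewrite /rational_diagram /two_bridge /twist_kinds map_flatten -map_comp.
congr (_ ++ flatten _ ++ _); apply: eq_map => i /=.
by rewrite /twist /= map_nseq /crossing_event.
Qed.

Definition tree_counts ns := foldl extend_counts (0, 1) (twist_kinds ns).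

Lemma card_spanning_trees_rational ns (S : {set {set gap_at (rational_diagram ns)}}) :
  checkerboard_shading S ->
  #|spanning_trees (checkerboard_graph S)| =
    if odd (size ns) then (tree_counts ns).1 else (tree_counts ns).2.
Proof.
move/(shading_unique (valid_rational ns))->; rewrite rational_two_bridge.
exact: card_spanning_trees_two_bridge.
Qed.

Lemma foldl_extend_counts_nseq ts m k :
  foldl extend_counts ts (nseq m k) =
    if k then (ts.1 + m * ts.2, ts.2) else (ts.1, ts.2 + m * ts.1).
Proof.
elim: m ts => [|m IHm] [t s] /=; first by rewrite !mul0n !addn0; case: k.
by rewrite IHm /extend_counts; case: (k); rewrite /= mulSn addnA.
Qed.

Lemma tree_counts_rcons ns m :
  let ts := tree_counts ns in
  tree_counts (rcons ns m) =
    if odd (size ns) then (ts.1, ts.2 + m * ts.1) else (ts.1 + m * ts.2, ts.2).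
Proof.
rewrite /tree_counts /twist_kinds size_rcons -[(size ns).+1]addn1 iotaD.
rewrite map_cat flatten_cat foldl_cat /= cats0 add0n nth_rcons ltnn eqxx foldl_extend_counts_nseq if_neg.
rewrite (_ : map _ _ = [seq nseq (nth 0 ns i) (odd i.+1) | i <- iota 0 (size ns)]) //.
by apply/eq_in_map=> i; rewrite mem_iota => /andP[_ lt_i]; rewrite nth_rcons lt_i.
Qed.

Theorem proposition7p1 (n : nat -> nat) (n_gt0 : forall i, 0 < i -> 0 < n i)
    (shaded : forall N : nat,
        {set {set gap_at (rational_diagram [seq n i | i <- iota 1 N])}})
    (shaded_ok : forall N : nat, checkerboard_shading (shaded N)) :
  let T := fun N : nat => #|spanning_trees (checkerboard_graph (shaded N))| in
  [/\ T 0 = 1,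
      T 1 = n 1 &
      forall N : nat, 1 <= N -> T N.+1 = n N.+1 * T N + T N.-1].
Proof.
pose ns N := [seq n i | i <- iota 1 N]; pose ts N := tree_counts (ns N).
move=> T; have TE N : T N = if odd N then (ts N).1 else (ts N).2.
  by rewrite /T card_spanning_trees_rational // size_map size_iota.
have tsS N : ts N.+1 = if odd N then ((ts N).1, (ts N).2 + n N.+1 * (ts N).1)
    else ((ts N).1 + n N.+1 * (ts N).2, (ts N).2).
  have nsS : ns N.+1 = rcons (ns N) (n N.+1).
    by rewrite /ns -[in LHS](addn1 N) iotaD map_cat cats1.
  by rewrite /ts nsS tree_counts_rcons size_map size_iota.
have ts0 : ts 0 = (0, 1) by [].
split=> [||[|N] // _]; rewrite !TE ?tsS ?ts0 //=; first by rewrite muln1.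
by case: (odd N); rewrite /= addnC.
Qed.
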